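(* Let $(A,\mu,\partial)$ be a unital GDQ ring, let $X\in A$ satisfy $\partial X=1\otimes 1$, and let $N=\operatorname{Ker}\partial$. Let $p\ge 1$ and let $\beta_1,\beta_2,\beta_3\in \mathfrak{M}_p(N)$ be such that $\beta_2-\beta_1(X\otimes I_p)\beta_3$ is invertible in $\mathfrak{M}_p(A)$. Then $$\alpha=\beta_3\bigl(\beta_2-\beta_1(X\otimes I_p)\beta_3\bigr)^{-1}\beta_1$$ is a corepresentation of $(A,\mu,\partial)$.
   Context: A generalized difference quotient ring (GDQ ring) is a triple $(A,\mu,\partial)$ where $A$ is an algebra over $\mathbb{C}$ with multiplication map $\mu:A\otimes A\to A$, and $\partial:A\to A\otimes A$ is a linear map that is coassociative, $(\partial\otimes \mathrm{id}_A)\circ\partial=(\mathrm{id}_A\otimes\partial)\circ\partial$, and a derivation, $\partial\circ\mu=(\mathrm{id}_A\otimes\mu)\circ(\partial\otimes\mathrm{id}_A)+(\mu\otimes\mathrm{id}_A)\circ(\mathrm{id}_A\otimes\partial)$. It is unital if $A$ has a unit $1$. Here $\otimes$ is the algebraic tensor product over $\mathbb{C}$. $\mathfrak{M}_p(A)$ denotes the $p\times p$ matrices over $A$, and $X\otimes I_p$ is the diagonal $p\times p$ matrix with all diagonal entries equal to $X$. A corepresentation of $(A,\mu,\partial)$ is a matrix $\alpha=(a_{ij})_{1\le i,j\le p}\in\mathfrak{M}_p(A)$ such that $\partial a_{ik}=\sum_{j=1}^p a_{ij}\otimes a_{jk}$ for all $1\le i,k\le p$. *)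

(* Defs.v *)
From HB Require Import structures.
From mathcomp Require Import all_boot all_algebra.
From mathcomp Require Import generic_quotient ring_quotient sesquilinear.
From mathcomp Require Import boolp reals complex.
From mathcomp Require Import finmap.
From mathcomp.multinomials Require Import monalg.

Set Implicit Arguments.
Unset Strict Implicit.
Unset Printing Implicit Defensive.

Import GRing.Theory.
Local Open Scope ring_scope.
Local Open Scope quotient_scope.

Section FreeModuleLift.
Variables (K : comNzRingType) (I : choiceType) (W : lmodType K) (h : I -> W).

Definition mlift (x : {malg K[I]}) : W := \sum_(i <- msupp x) x@_i *: h i.

Lemma mliftEw (x : {malg K[I]}) (s : {fset I}) :
  (msupp x `<=` s)%fset -> mlift x = \sum_(i <- s) x@_i *: h i.
Proof.
move=> le; rewrite /mlift (big_fset_incl _ le) // => i _ /mcoeff_outdom ->.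
by rewrite scale0r.
Qed.

Lemma mlift_is_linear : linear mlift.
Proof.
move=> a x y; set s := (msupp x `|` msupp y)%fset.
have sx : (msupp x `<=` s)%fset by exact: fsubsetUl.
have sy : (msupp y `<=` s)%fset by exact: fsubsetUr.
have sxy : (msupp (a *: x + y) `<=` s)%fset.
  apply: fsubset_trans (msuppD_le _ _) _; apply: fsetSU.
  exact: msuppZ_le.
rewrite (mliftEw sx) (mliftEw sy) (mliftEw sxy) scaler_sumr -big_split /=.
by apply: eq_bigr => i _; rewrite mcoeffD mcoeffZ scalerDl scalerA.
Qed.

HB.instance Definition _ :=
  GRing.isLinear.Build K {malg K[I]} W _ mlift mlift_is_linear.

Lemma mliftU i : mlift << i >> = h i.
Proof. by rewrite (mliftEw msuppU_le) big_seq_fset1 mcoeffUU scale1r. Qed.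

End FreeModuleLift.

(* The operations on tensors are sealed with this key, so that unification does
   not unfold the quotient construction. *)
Fact tens_key : unit. Proof. exact: tt. Qed.

Section TensorKernel.
Variables (K : comNzRingType) (U V : lmodType K).

(* The submodule spanned by the relations making (u, v) |-> <<(u, v)>> bilinear. *)
Inductive tens_span : {malg K[(U * V)%type]} -> Prop :=
| TensSpan0 : tens_span 0
| TensSpanD x y of tens_span x & tens_span y : tens_span (x + y)
| TensSpanZ a x of tens_span x : tens_span (a *: x)
| TensSpanl a u u' v :
    tens_span (<< (a *: u + u', v) >> - a *: << (u, v) >> - << (u', v) >>)
| TensSpanr a u v v' :
    tens_span (<< (u, a *: v + v') >> - a *: << (u, v) >> - << (u, v') >>).

Definition tens_ker : {pred {malg K[(U * V)%type]}} := fun x => `[< tens_span x >].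

Lemma tens_kerP x : reflect (tens_span x) (x \in tens_ker).
Proof. exact: asboolP. Qed.

Lemma tens_ker_zmod : zmod_closed tens_ker.
Proof.
split; first by apply/tens_kerP; constructor.
move=> x y /tens_kerP hx /tens_kerP hy; apply/tens_kerP.
by rewrite -scaleN1r; do 2?constructor.
Qed.

HB.instance Definition _ :=
  GRing.isZmodClosed.Build {malg K[(U * V)%type]} tens_ker tens_ker_zmod.

Definition tensor : Type := {ideal_quot tens_ker}.

HB.instance Definition _ := Choice.on tensor.
HB.instance Definition _ := Quotient.on tensor.

Lemma tensor_eqP (x y : {malg K[(U * V)%type]}) :
  \pi_tensor x = \pi_tensor y <-> tens_span (x - y).
Proof.
split=> [/eqP|h]; first by rewrite -Quotient.idealrBE => /tens_kerP.
by apply/eqP; rewrite -Quotient.idealrBE; apply/tens_kerP.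
Qed.

Definition tensor_zero : tensor :=
  locked_with tens_key (0 : {ideal_quot tens_ker}).
Definition tensor_add : tensor -> tensor -> tensor :=
  locked_with tens_key (+%R : {ideal_quot tens_ker} -> _).
Definition tensor_opp : tensor -> tensor :=
  locked_with tens_key (-%R : {ideal_quot tens_ker} -> _).

Lemma tensor_addA : associative tensor_add.
Proof. by rewrite /tensor_add locked_withE; apply: addrA. Qed.
Lemma tensor_addC : commutative tensor_add.
Proof. by rewrite /tensor_add locked_withE; apply: addrC. Qed.
Lemma tensor_add0 : left_id tensor_zero tensor_add.
Proof. by rewrite /tensor_zero /tensor_add !locked_withE; apply: add0r. Qed.
Lemma tensor_addN : left_inverse tensor_zero tensor_opp tensor_add.
Proof.
by rewrite /tensor_zero /tensor_add /tensor_opp !locked_withE; apply: addNr.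
Qed.

HB.instance Definition _ := GRing.isZmodule.Build tensor
  tensor_addA tensor_addC tensor_add0 tensor_addN.

Lemma pi_tensorD (x y : {malg K[(U * V)%type]}) :
  \pi_tensor (x + y) = \pi_tensor x + \pi_tensor y.
Proof.
transitivity (tensor_add (\pi_tensor x) (\pi_tensor y)) => //.
rewrite /tensor_add locked_withE; exact: Quotient.pi_add.
Qed.

Definition tensor_scale : K -> tensor -> tensor :=
  locked_with tens_key (fun a t => \pi_tensor (a *: repr t)).

Lemma tensor_scaleE a x : tensor_scale a (\pi_tensor x) = \pi_tensor (a *: x).
Proof.
rewrite /tensor_scale locked_withE; apply/tensor_eqP; rewrite -scalerBr; apply: TensSpanZ.
by apply/tensor_eqP; rewrite reprK.
Qed.

Lemma tensorW (P : tensor -> Prop) :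
  (forall x : {malg K[(U * V)%type]}, P (\pi_tensor x)) -> forall t, P t.
Proof. by move=> h t; rewrite -[t]reprK; apply: h. Qed.

Lemma tensor_scaleA a b t :
  tensor_scale a (tensor_scale b t) = tensor_scale (a * b) t.
Proof. by elim/tensorW: t => x; rewrite !tensor_scaleE scalerA. Qed.

Lemma tensor_scale1 : left_id 1 tensor_scale.
Proof. by elim/tensorW=> x; rewrite tensor_scaleE scale1r. Qed.

Lemma tensor_scaleDr : right_distributive tensor_scale +%R.
Proof.
move=> a; elim/tensorW=> x; elim/tensorW=> y.
by rewrite -pi_tensorD !tensor_scaleE scalerDr pi_tensorD.
Qed.

Lemma tensor_scaleDl t : {morph tensor_scale^~ t : a b / a + b}.
Proof.
elim/tensorW: t => x a b.
by rewrite !tensor_scaleE scalerDl pi_tensorD.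
Qed.

HB.instance Definition _ := GRing.Zmodule_isLmodule.Build K tensor
  tensor_scaleA tensor_scale1 tensor_scaleDr tensor_scaleDl.

Definition tens : U -> V -> tensor :=
  locked_with tens_key (fun u v => \pi_tensor << (u, v) >>).

Lemma tens_def u v : tens u v = \pi_tensor << (u, v) >>.
Proof. by rewrite /tens locked_withE. Qed.

Lemma pi_tensorZ a (x : {malg K[(U * V)%type]}) :
  \pi_tensor (a *: x) = a *: \pi_tensor x.
Proof. by rewrite -tensor_scaleE. Qed.

Lemma tens_is_bilinear : bilinear_for *:%R *:%R tens.
Proof.
split=> [v a u u'|u a v v'] /=; rewrite !tens_def -pi_tensorZ -pi_tensorD.
  by apply/tensor_eqP; rewrite opprD addrA; exact: TensSpanl.
by apply/tensor_eqP; rewrite opprD addrA; exact: TensSpanr.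
Qed.

HB.instance Definition _ :=
  bilinear_isBilinear.Build K U V tensor _ _ tens tens_is_bilinear.

Lemma tensor_ind (P : tensor -> Prop) :
  P 0 -> (forall s t, P s -> P t -> P (s + t)) -> (forall u v, P (tens u v)) ->
  forall t, P t.
Proof.
move=> P0 PD Pt; elim/tensorW=> x; rewrite (monalgE x).
elim: (enum_fset _) => [|[u v] s IHs].
  rewrite big_nil; have -> // : \pi_tensor 0 = 0.
  by rewrite -(scale0r (0 : {malg _[_]})) pi_tensorZ scale0r.
rewrite big_cons pi_tensorD; apply: PD => //.
have -> : << x@_(u, v) *g (u, v) >> = x@_(u, v) *: << (u, v) >>.
  by apply/malgP=> k; rewrite mcoeffZ !mcoeffU mulrnAr mulr1.
rewrite pi_tensorZ -tens_def.
by have <- : tens (x@_(u, v) *: u) v = x@_(u, v) *: tens u v by exact: linearZl.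
Qed.

Section Lift.
Variables (W : lmodType K) (f : U -> V -> W).

Definition tlift : tensor -> W :=
  locked_with tens_key (fun t => mlift (fun uv => f uv.1 uv.2) (repr t)).

End Lift.

Section LiftTheory.
Variables (W : lmodType K) (f : {bilinear U -> V -> W}).

Lemma tlift_pi (x : {malg K[(U * V)%type]}) :
  tlift f (\pi_tensor x) = mlift (fun uv => f uv.1 uv.2) x.
Proof.
apply/eqP; rewrite -subr_eq0 /tlift locked_withE -linearB.
have : tens_span (repr (\pi_tensor x) - x) by apply/tensor_eqP; rewrite reprK.
move=> h; apply/eqP; elim: h => {x} [|x y _ hx _ hy|a x _ hx|a u u' v|a u v v'].
- by rewrite linear0.
- by rewrite linearD hx hy addr0.
- by rewrite linearZ /= hx scaler0.
- by rewrite !linearB linearZ /= !mliftU /= linearPl -addrA -opprD subrr.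
- by rewrite !linearB linearZ /= !mliftU /= linearPr -addrA -opprD subrr.
Qed.

Lemma tlift_is_linear : linear (tlift f).
Proof.
move=> a; elim/tensorW=> x; elim/tensorW=> y.
by rewrite -pi_tensorZ -pi_tensorD !tlift_pi linearP.
Qed.

HB.instance Definition _ :=
  GRing.isLinear.Build K tensor W _ (tlift f) tlift_is_linear.

Lemma tliftE u v : tlift f (tens u v) = f u v.
Proof. by rewrite tens_def tlift_pi mliftU. Qed.

End LiftTheory.

Lemma tensor_ext (W : lmodType K) (g h : {linear tensor -> W}) :
  (forall u v, g (tens u v) = h (tens u v)) -> g =1 h.
Proof.
move=> gh; elim/tensor_ind=> [|s t hs ht|//]; first by rewrite !linear0.
by rewrite !linearD /= hs ht.
Qed.

End TensorKernel.

Arguments tens {K U V} u v.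
Arguments tlift {K U V W} f t.

Notation "U ⊗ V" := (tensor U V)
  (at level 40, left associativity) : type_scope.
Notation "u ⊗ v" := (tens u v)
  (at level 40, left associativity) : ring_scope.

Section TensorMap.
Variables (K : comNzRingType) (U U' V V' : lmodType K).
Variables (f : {linear U -> U'}) (g : {linear V -> V'}).

Definition tmap_fun (u : U) (v : V) : (U' ⊗ V')%type := f u ⊗ g v.

Lemma tmap_fun_is_bilinear : bilinear_for *:%R *:%R tmap_fun.
Proof.
by split=> [v|u] a x y; rewrite /tmap_fun linearP ?linearPl ?linearPr.
Qed.

HB.instance Definition _ := bilinear_isBilinear.Build K U V (U' ⊗ V')%type _ _
  tmap_fun tmap_fun_is_bilinear.

Definition tmap : (U ⊗ V)%type -> (U' ⊗ V')%type := tlift tmap_fun.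

HB.instance Definition _ := GRing.Linear.on tmap.

Lemma tmapE u v : tmap (u ⊗ v) = f u ⊗ g v.
Proof. exact: tliftE. Qed.

End TensorMap.

Section TensorAssoc.
Variables (K : comNzRingType) (U V W : lmodType K).
Local Notation Tl := ((U ⊗ V) ⊗ W)%type.
Local Notation Tr := (U ⊗ (V ⊗ W))%type.

Definition tassoc_fun2 (w : W) (u : U) (v : V) : Tr := u ⊗ (v ⊗ w).

Lemma tassoc_fun2_is_bilinear w : bilinear_for *:%R *:%R (tassoc_fun2 w).
Proof.
by split=> [v|u] a x y; rewrite /tassoc_fun2 !(linearPl, linearPr).
Qed.

HB.instance Definition _ w := bilinear_isBilinear.Build K U V Tr _ _
  (tassoc_fun2 w) (tassoc_fun2_is_bilinear w).

Definition tassoc_fun (t : (U ⊗ V)%type) (w : W) : Tr :=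
  tlift (tassoc_fun2 w) t.

Lemma tassoc_fun_is_bilinear : bilinear_for *:%R *:%R tassoc_fun.
Proof.
split=> [w|t] a x y; rewrite /tassoc_fun; first by rewrite linearP.
elim/tensor_ind: t => [|s t hs ht|u v].
- by rewrite !linear0 /= scaler0 addr0.
- by rewrite !linearD /= hs ht ?scalerDr addrACA.
- by rewrite !tliftE /= /tassoc_fun2 !linearPr.
Qed.

HB.instance Definition _ := bilinear_isBilinear.Build K (U ⊗ V)%type W Tr _ _
  tassoc_fun tassoc_fun_is_bilinear.

Definition tassoc : Tl -> Tr := tlift tassoc_fun.

HB.instance Definition _ := GRing.Linear.on tassoc.

Lemma tassocE u v w : tassoc (u ⊗ v ⊗ w) = u ⊗ (v ⊗ w).
Proof. by rewrite /tassoc tliftE /= /tassoc_fun tliftE. Qed.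

Definition tassocV_fun2 (u : U) (v : V) (w : W) : Tl := u ⊗ v ⊗ w.

Lemma tassocV_fun2_is_bilinear u : bilinear_for *:%R *:%R (tassocV_fun2 u).
Proof.
by split=> [w|v] a x y; rewrite /tassocV_fun2 !(linearPl, linearPr).
Qed.

HB.instance Definition _ u := bilinear_isBilinear.Build K V W Tl _ _
  (tassocV_fun2 u) (tassocV_fun2_is_bilinear u).

Definition tassocV_fun (u : U) (t : (V ⊗ W)%type) : Tl :=
  tlift (tassocV_fun2 u) t.

Lemma tassocV_fun_is_bilinear : bilinear_for *:%R *:%R tassocV_fun.
Proof.
split=> [t|u] a x y; rewrite /tassocV_fun; last by rewrite linearP.
elim/tensor_ind: t => [|s t hs ht|v w].
- by rewrite !linear0 /= scaler0 addr0.
- by rewrite !linearD /= hs ht ?scalerDr addrACA.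
- by rewrite !tliftE /= /tassocV_fun2 !linearPl.
Qed.

HB.instance Definition _ := bilinear_isBilinear.Build K U (V ⊗ W)%type Tl _ _
  tassocV_fun tassocV_fun_is_bilinear.

Definition tassocV : Tr -> Tl := tlift tassocV_fun.

HB.instance Definition _ := GRing.Linear.on tassocV.

Lemma tassocVE u v w : tassocV (u ⊗ (v ⊗ w)) = u ⊗ v ⊗ w.
Proof. by rewrite /tassocV tliftE /= /tassocV_fun tliftE. Qed.

Lemma tassocK : cancel tassoc tassocV.
Proof.
elim/tensor_ind=> [|s t hs ht|t w]; first by rewrite !linear0.
  by rewrite !linearD /= hs ht.
elim/tensor_ind: t => [|s t hs ht|u v]; first by rewrite linear0l !linear0.
  by rewrite linearDl !linearD /= hs ht.
by rewrite tassocE tassocVE.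
Qed.

Lemma tassocVK : cancel tassocV tassoc.
Proof.
elim/tensor_ind=> [|s t hs ht|u t]; first by rewrite !linear0.
  by rewrite !linearD /= hs ht.
elim/tensor_ind: t => [|s t hs ht|v w]; first by rewrite linear0r !linear0.
  by rewrite linearDr !linearD /= hs ht.
by rewrite tassocVE tassocE.
Qed.

End TensorAssoc.

Section Multiplication.
Variables (K : comNzRingType) (A : algType K).

Lemma mulr_is_bilinear : bilinear_for *:%R *:%R ( *%R : A -> A -> A).
Proof.
split=> [y|x] a u v /=; first by rewrite mulrDl scalerAl.
by rewrite mulrDr scalerAr.
Qed.

HB.instance Definition _ :=
  bilinear_isBilinear.Build K A A A _ _ ( *%R : A -> A -> A) mulr_is_bilinear.

Definition mu : (A ⊗ A)%type -> A := tlift ( *%R : A -> A -> A).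

HB.instance Definition _ := GRing.Linear.on mu.

Lemma muE a b : mu (a ⊗ b) = a * b.
Proof. exact: tliftE. Qed.

End Multiplication.
Arguments mu {K A} t.

(* [algType K] already provides the unit, so this is the unital notion. Triple
   tensor products are compared in A ⊗ (A ⊗ A) or (A ⊗ A) ⊗ A by inserting the
   associator [tassoc] or its inverse [tassocV]. *)
HB.mixin Record isGDQ (K : comNzRingType) A of GRing.Algebra K A := {
  partial : {linear A -> (A ⊗ A)%type};
  partial_coassoc : forall a : A,
    tassoc (tmap partial (@idfun A) (partial a)) =
    tmap (@idfun A) partial (partial a);
  partial_derivation : forall t : (A ⊗ A)%type,
    partial (mu t) =
      tmap (@idfun A) (@mu K A) (tassoc (tmap partial (@idfun A) t)) +
      tmap (@mu K A) (@idfun A) (tassocV (tmap (@idfun A) partial t))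
}.

#[short(type="gdqType")]
HB.structure Definition GDQ (K : comNzRingType) :=
  {A of isGDQ K A & GRing.Algebra K A}.

Arguments partial {K} s.

Notation "∂ x" := (partial _ x) (at level 10, x at level 8) : ring_scope.

Definition gdq_ker (K : comNzRingType) (A : gdqType K) : {pred A} :=
  [pred a | ∂ a == 0].

Definition corepresentation (K : comNzRingType) (A : gdqType K) (p : nat)
    (alpha : 'M[A]_p) : Prop :=
  forall i k, ∂ (alpha i k) = \sum_(j < p) alpha i j ⊗ alpha j k.

Arguments gdq_ker {K} A.
Arguments corepresentation {K A p} alpha.

(* Main.v *)
(** The map ∂ : A -> A ⊗ A is a derivation for the outer bimodule structure
    a (u ⊗ v) b = (a u) ⊗ (v b), and so is its entrywise lift to matrices.  With
    (M ⊙ N)_ik = \sum_j M_ij ⊗ N_jk and G = β2 - β1 X β3 one gets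
    ∂G = - β1 ⊙ β3, hence, differentiating G γ = 1,
    ∂γ = - γ (∂G) γ = (γ β1) ⊙ (β3 γ).  Multiplying by the constants β3 on the
    left and β1 on the right yields α ⊙ α. *)
From HB Require Import structures.
Require Import Defs.
From mathcomp Require Import all_boot all_algebra.
From mathcomp Require Import reals complex.

Import GRing.Theory.
Local Open Scope ring_scope.

Section OuterBimodule.
Set Implicit Arguments.
Unset Strict Implicit.
Variables (K : comNzRingType) (A : algType K).
Local Notation AA := (A ⊗ A)%type.

(** Named so that each can carry a linear structure, since [tmap] takes bundled linear maps. *)
Definition lmul (a x : A) : A := a * x.
Definition rmul (b x : A) : A := x * b.

Lemma lmul_is_linear a : linear (lmul a).
Proof. by move=> c x y; rewrite /lmul mulrDr scalerAr. Qed.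
HB.instance Definition _ a := GRing.isLinear.Build K A A _ _ (lmul_is_linear a).

Lemma rmul_is_linear b : linear (rmul b).
Proof. by move=> c x y; rewrite /rmul mulrDl scalerAl. Qed.
HB.instance Definition _ b := GRing.isLinear.Build K A A _ _ (rmul_is_linear b).

Definition lact (a : A) : AA -> AA := tmap (lmul a) (@idfun A).
HB.instance Definition _ a := GRing.Linear.on (lact a).

Definition ract (b : A) : AA -> AA := tmap (@idfun A) (rmul b).
HB.instance Definition _ b := GRing.Linear.on (ract b).

Lemma lactE a u v : lact a (u ⊗ v) = (a * u) ⊗ v.
Proof. by rewrite /lact tmapE. Qed.

Lemma ractE b u v : ract b (u ⊗ v) = u ⊗ (v * b).
Proof. by rewrite /ract tmapE. Qed.

Lemma lact1 t : lact 1 t = t.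
Proof.
elim/tensor_ind: t => [|s t hs ht|u v]; first by rewrite linear0.
  by rewrite linearD /= hs ht.
by rewrite lactE mul1r.
Qed.

Lemma lact_mul a b t : lact a (lact b t) = lact (a * b) t.
Proof.
elim/tensor_ind: t => [|s t hs ht|u v]; first by rewrite !linear0.
  by rewrite !linearD /= hs ht.
by rewrite !lactE mulrA.
Qed.

(** The linear structure on [lact a] concerns the tensor only. Additivity in the acting element is
    obtained by reducing to pure tensors, where it is linearity of [⊗] on the left. *)
Lemma lact_suml (I : Type) (r : seq I) (F : I -> A) t :
  lact (\sum_(i <- r) F i) t = \sum_(i <- r) lact (F i) t.
Proof.
elim/tensor_ind: t => [|s t hs ht|u v].
- by rewrite linear0 big1 // => i _; rewrite linear0.
- rewrite linearD /= hs ht -big_split; apply: eq_bigr => i _.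
  by rewrite linearD.
- rewrite lactE mulr_suml linear_sumlz; apply: eq_bigr => i _.
  by rewrite lactE.
Qed.

Lemma lact0l t : lact 0 t = 0.
Proof. by have := lact_suml [::] (fun _ : A => 0) t; rewrite !big_nil. Qed.

End OuterBimodule.

Section TensorMatrices.
Set Implicit Arguments.
Unset Strict Implicit.
Variables (K : comNzRingType) (A : algType K).
Local Notation AA := (A ⊗ A)%type.

Definition lactmx m n p (M : 'M[A]_(m, n)) (T : 'M[AA]_(n, p)) : 'M[AA]_(m, p) :=
  \matrix_(i, k) \sum_j lact (M i j) (T j k).

Definition ractmx m n p (T : 'M[AA]_(m, n)) (M : 'M[A]_(n, p)) : 'M[AA]_(m, p) :=
  \matrix_(i, k) \sum_j ract (M j k) (T i j).

Definition tensmx m n p (M : 'M[A]_(m, n)) (N : 'M[A]_(n, p)) : 'M[AA]_(m, p) :=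
  \matrix_(i, k) \sum_j M i j ⊗ N j k.

Lemma lactmx1 n p (T : 'M[AA]_(n, p)) : lactmx 1%:M T = T.
Proof.
apply/matrixP=> i k; rewrite mxE (bigD1 i) //= !mxE eqxx lact1 big1 ?addr0 //.
move=> j /negPf ji; rewrite mxE eq_sym ji.
(* Off the diagonal the coefficient [1 *+ false] computes to [0]. *)
exact: lact0l.
Qed.

Lemma lactmx0 m n p (M : 'M[A]_(m, n)) : lactmx M (0 : 'M[AA]_(n, p)) = 0.
Proof.
by apply/matrixP=> i k; rewrite !mxE big1 // => j _; rewrite mxE linear0.
Qed.

Lemma ractmx0 m n p (M : 'M[A]_(n, p)) : ractmx (0 : 'M[AA]_(m, n)) M = 0.
Proof.
by apply/matrixP=> i k; rewrite !mxE big1 // => j _; rewrite mxE linear0.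
Qed.

Lemma ractmxN m n p (T : 'M[AA]_(m, n)) (M : 'M[A]_(n, p)) :
  ractmx (- T) M = - ractmx T M.
Proof.
apply/matrixP=> i k; rewrite !mxE -sumrN; apply: eq_bigr => j _.
by rewrite mxE linearN.
Qed.

Lemma lactmx_mul m n p q (M : 'M[A]_(m, n)) (N : 'M[A]_(n, p))
    (T : 'M[AA]_(p, q)) : lactmx M (lactmx N T) = lactmx (M *m N) T.
Proof.
apply/matrixP=> i k; rewrite !mxE.
under eq_bigr do rewrite mxE linear_sum.
rewrite exchange_big; apply: eq_bigr => j _.
rewrite mxE lact_suml; apply: eq_bigr => l _; exact: lact_mul.
Qed.

(** The left outer action touches only the first tensor factor, so a matrix acting on the left is
    absorbed into the left argument of [tensmx]. *)
Lemma lactmx_tens m n p q (P : 'M[A]_(m, n)) (M : 'M[A]_(n, p))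
    (N : 'M[A]_(p, q)) : lactmx P (tensmx M N) = tensmx (P *m M) N.
Proof.
apply/matrixP=> i k; rewrite !mxE.
under eq_bigr do rewrite mxE linear_sum.
rewrite exchange_big; apply: eq_bigr => j _.
rewrite mxE linear_sumlz; apply: eq_bigr => l _; exact: lactE.
Qed.

Lemma ractmx_tens m n p q (M : 'M[A]_(m, n)) (N : 'M[A]_(n, p))
    (P : 'M[A]_(p, q)) : ractmx (tensmx M N) P = tensmx M (N *m P).
Proof.
apply/matrixP=> i k; rewrite !mxE.
under eq_bigr do rewrite mxE linear_sum.
rewrite exchange_big; apply: eq_bigr => j _.
rewrite mxE linear_sumr; apply: eq_bigr => l _; exact: ractE.
Qed.

End TensorMatrices.

Section Derivation.
Set Implicit Arguments.
Unset Strict Implicit.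
Variables (K : comNzRingType) (A : gdqType K).
Local Notation AA := (A ⊗ A)%type.

Lemma partialM (a b : A) : ∂ (a * b) = ract b (∂ a) + lact a (∂ b).
Proof.
rewrite -muE partial_derivation !tmapE; congr (_ + _).
  (* Both sides are additive in [∂ a]; a pure term [u ⊗ v] gives [(u ⊗ v) ⊗ b], which reassociates
     and multiplies out to [u ⊗ (v * b)]. *)
  elim/tensor_ind: (∂ a) => [|s t hs ht|u v].
  - by rewrite linear0l !linear0.
  - by rewrite linearDl !linearD /= hs ht.
  - by rewrite tassocE tmapE /= muE ractE.
elim/tensor_ind: (∂ b) => [|s t hs ht|u v].
- by rewrite linear0r !linear0.
- by rewrite linearDr !linearD /= hs ht.
- by rewrite tassocVE tmapE /= muE lactE.
Qed.

Definition partialmx m n (M : 'M[A]_(m, n)) : 'M[AA]_(m, n) :=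
  map_mx (partial A) M.

Lemma partialmxM m n p (M : 'M[A]_(m, n)) (N : 'M[A]_(n, p)) :
  partialmx (M *m N) = ractmx (partialmx M) N + lactmx M (partialmx N).
Proof.
apply/matrixP=> i k; rewrite !mxE linear_sum -big_split; apply: eq_bigr => j _.
by rewrite !mxE partialM.
Qed.

Lemma partialmx_ker m n (M : 'M[A]_(m, n)) :
  M \is a mxOver (gdq_ker A) -> partialmx M = 0.
Proof.
by move/mxOverP=> hM; apply/matrixP=> i j; rewrite !mxE; apply/eqP/(hM i j).
Qed.

Lemma partial1 : ∂ (1 : A) = 0.
Proof.
have ract1 (t : AA) : ract 1 t = t.
  elim/tensor_ind: t => [|s t hs ht|u v]; first by rewrite linear0.
    by rewrite linearD /= hs ht.
  by rewrite ractE mulr1.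
(* The Leibniz rule for [1 * 1] reads [∂ 1 = ∂ 1 + ∂ 1]. *)
have := partialM 1 1; rewrite mulr1 ract1 lact1 => h.
by apply: (addrI (∂ (1 : A))); rewrite addr0.
Qed.

Lemma partialmx1 n : partialmx (1%:M : 'M[A]_n) = 0.
Proof.
apply/matrixP=> i j; rewrite !mxE; case: (i == j); last by rewrite linear0.
exact: partial1.
Qed.

(** Both sides are diagonal with entries [1 ⊗ 1]: elsewhere some tensor factor is [0]. *)
Lemma partialmx_scalar n (X : A) : ∂ X = 1 ⊗ 1 ->
  partialmx (X%:M : 'M[A]_n) = tensmx 1%:M 1%:M.
Proof.
move=> hX; apply/matrixP=> i k; rewrite !mxE (bigD1 i) //= big1 => [|j ji].
  rewrite !mxE eqxx addr0; case: (i == k) => //=.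
  by rewrite linear0 linear0r.
by rewrite mxE eq_sym (negPf ji) linear0l.
Qed.

End Derivation.

(* [X%:M] is X ⊗ I_p; [gamma] is the two-sided inverse of
   beta2 - beta1 (X ⊗ I_p) beta3, 'M[A]_p having no inversion operation over a
   noncommutative A. *)
Theorem proposition3p1 (R : realType) (A : gdqType R[i]) (X : A)
    (hX : ∂ X = 1 ⊗ 1) (p : nat) (hp : (0 < p)%N)
    (beta1 beta2 beta3 : 'M[A]_p)
    (hb1 : beta1 \is a mxOver (gdq_ker A))
    (hb2 : beta2 \is a mxOver (gdq_ker A))
    (hb3 : beta3 \is a mxOver (gdq_ker A))
    (gamma : 'M[A]_p)
    (hgammar : (beta2 - beta1 *m X%:M *m beta3) *m gamma = 1%:M)
    (hgammal : gamma *m (beta2 - beta1 *m X%:M *m beta3) = 1%:M) :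
  corepresentation (beta3 *m gamma *m beta1).
Proof.
have d1 := partialmx_ker hb1; have d2 := partialmx_ker hb2.
have d3 := partialmx_ker hb3.
move: hgammar hgammal; set G := beta2 - _ => hGg hgG.
have dG : partialmx G = - tensmx beta1 beta3.
  have -> : partialmx G = partialmx beta2 - partialmx (beta1 *m X%:M *m beta3).
    by apply/matrixP=> i k; rewrite !mxE linearB.
  (* The beta matrices are constants, so the only Leibniz term left is the one that differentiates
     [X%:M]. *)
  rewrite d2 sub0r !partialmxM d1 d3 lactmx0 addr0 ractmx0 add0r.
  by rewrite (partialmx_scalar _ hX) lactmx_tens ractmx_tens mulmx1 mul1mx.
have dg : partialmx gamma = tensmx (gamma *m beta1) (beta3 *m gamma).
  (* The right inverse identity is differentiated, giving the value of [lactmx G (partialmx gamma)];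
     the left inverse identity then cancels [G]. *)
  have := partialmx1 A p; rewrite -hGg partialmxM dG ractmxN ractmx_tens.
  rewrite addrC => /subr0_eq h.
  by rewrite -[LHS]lactmx1 -hgG -lactmx_mul h lactmx_tens.
have : partialmx (beta3 *m gamma *m beta1) =
    tensmx (beta3 *m gamma *m beta1) (beta3 *m gamma *m beta1).
  rewrite !partialmxM d1 d3 lactmx0 addr0 ractmx0 add0r dg.
  (* [beta3] enters the left factor and [beta1] the right one; associativity makes the two factors
     the same matrix. *)
  by rewrite lactmx_tens ractmx_tens mulmxA.
by move=> /matrixP h i k; have := h i k; rewrite !mxE.
Qed.
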